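(* Let $\mathbb X_i$, $i\in I$, be pairwise disjoint connected $L_b$-structures. Then $\bigcup_{i\in I}\mathbb X_i$ is reversible iff $\bigcup_{i\in J}\mathbb X_i$ is reversible for every non-empty $J\subseteq I$. Consequently, if $\bigcup_{i\in I}\mathbb X_i$ is reversible, then every $\mathbb X_i$, $i\in I$, is reversible.
   Context: An $L_b$-structure is a pair $\langle X,\rho\rangle$ with $\rho\subseteq X^2$. A homomorphism $f:\langle X,\rho\rangle\to\langle Y,\sigma\rangle$ is a map with $\langle x,y\rangle\in\rho\Rightarrow\langle f(x),f(y)\rangle\in\sigma$; a condensation is a bijective homomorphism. A structure is reversible iff every condensation from it to itself is an automorphism. The components of $\langle X,\rho\rangle$ are the classes of the smallest equivalence relation on $X$ containing $\rho$; the structure is connected iff it has exactly one component. ''Pairwise disjoint'' means the domains are pairwise disjoint, and $\bigcup_{i\in J}\langle X_i,\rho_i\rangle=\langle\bigcup_{i\in J}X_i,\bigcup_{i\in J}\rho_i\rangle$. *)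

(* Defs.v *)
From mathcomp Require Import all_boot.
From mathcomp Require Import boolp classical_sets functions.

Set Implicit Arguments.
Unset Strict Implicit.
Unset Printing Implicit Defensive.

Local Open Scope classical_set_scope.

(* The domain is a subset of an ambient type, so that disjointness and union of
   domains are meaningful. *)
Record Lb_structure (T : Type) := LbStructure {
  Lb_dom : set T;
  Lb_rel : set (T * T);
  Lb_rel_sub : Lb_rel `<=` Lb_dom `*` Lb_dom }.

(* Maps between structures are total functions on the ambient types, of which
   only the restriction to the domain is constrained. In [reversible] this loses
   nothing: every self-map of a domain extends by the identity. *)
Definition homomorphism (T U : Type) (X : Lb_structure T) (Y : Lb_structure U)
    (f : T -> U) : Prop :=
  set_fun (Lb_dom X) (Lb_dom Y) f /\
  forall x y, Lb_rel X (x, y) -> Lb_rel Y (f x, f y).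

Definition condensation (T U : Type) (X : Lb_structure T) (Y : Lb_structure U)
    (f : T -> U) : Prop :=
  homomorphism X Y f /\ set_bij (Lb_dom X) (Lb_dom Y) f.

Definition isomorphism (T U : Type) (X : Lb_structure T) (Y : Lb_structure U)
    (f : T -> U) : Prop :=
  set_bij (Lb_dom X) (Lb_dom Y) f /\
  forall x y, Lb_dom X x -> Lb_dom X y ->
    (Lb_rel X (x, y) <-> Lb_rel Y (f x, f y)).

Definition automorphism (T : Type) (X : Lb_structure T) (f : T -> T) : Prop :=
  isomorphism X X f.

Definition reversible (T : Type) (X : Lb_structure T) : Prop :=
  forall f : T -> T, condensation X X f -> automorphism X f.

Definition equivalence_on (T : Type) (D : set T) (E : set (T * T)) : Prop :=
  [/\ E `<=` D `*` D,
      forall x, D x -> E (x, x),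
      forall x y, E (x, y) -> E (y, x) &
      forall x y z, E (x, y) -> E (y, z) -> E (x, z)].

Definition Lb_equiv (T : Type) (X : Lb_structure T) : set (T * T) :=
  smallest (equivalence_on (Lb_dom X)) (Lb_rel X).

Definition components (T : Type) (X : Lb_structure T) : set (set T) :=
  [set [set y | Lb_equiv X (x, y)] | x in Lb_dom X].

Definition Lb_connected (T : Type) (X : Lb_structure T) : Prop :=
  exists C : set T, components X = [set C].

Definition pairwise_disjoint (T I : Type) (X : I -> Lb_structure T) : Prop :=
  trivIset setT (fun i => Lb_dom (X i)).

Lemma Lb_union_sub (T I : Type) (J : set I) (X : I -> Lb_structure T) :
  \bigcup_(i in J) Lb_rel (X i) `<=`
  (\bigcup_(i in J) Lb_dom (X i)) `*` (\bigcup_(i in J) Lb_dom (X i)).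
Proof. by move=> p [i Ji /Lb_rel_sub[p1 p2]]; split; exists i. Qed.

Definition Lb_union (T I : Type) (J : set I) (X : I -> Lb_structure T) :
    Lb_structure T :=
  LbStructure (@Lb_union_sub T I J X).

(* Main.v *)
Require Import Defs.
From mathcomp Require Import all_boot.
From mathcomp Require Import boolp classical_sets functions.

Set Implicit Arguments.
Unset Strict Implicit.
Unset Printing Implicit Defensive.

Local Open Scope classical_set_scope.

(** No edge of a disjoint union crosses the boundary of a subunion. Hence a
    condensation of the subunion, extended by the identity, is a condensation of
    the whole union, and an edge that it adds in the subunion is added in the
    whole union as well. *)

Lemma set_bij_patch (T U : Type) (A C : set T) (B D : set U) (f g : T -> U) :
  [disjoint A & C] -> [disjoint B & D] ->
  set_bij A B f -> set_bij C D g -> set_bij (A `|` C) (B `|` D) (patch g A f).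
Proof.
move=> AC BD /Pbij[f' ->] /Pbij[g' ->].
(* [glue AC BD f' g'] is convertible to [patch g' A f'], and has a canonical
   bijection structure. *)
exact: (bij (f := [bij of glue AC BD f' g'])).
Qed.

Lemma set_bij_patch_id (T : Type) (A B : set T) (f : T -> T) :
  A `<=` B -> set_bij A A f -> set_bij B B (patch id A f).
Proof.
move=> AB fbij; rewrite -(setDUK AB).
have disjA : [disjoint A & B `\` A] by exact/disj_setPRL/subDsetr.
by apply: set_bij_patch => //; split=> // x; exists x.
Qed.

Lemma reversible_dom0 (T : Type) (X : Lb_structure T) :
  Lb_dom X = set0 -> reversible X.
Proof. by move=> X0 f [_ fbij]; split=> // x y; rewrite X0. Qed.

Definition Lb_summand (T : Type) (X Z : Lb_structure T) : Prop :=
  Lb_dom X `<=` Lb_dom Z /\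
  forall x y, Lb_dom X x \/ Lb_dom X y -> Lb_rel Z (x, y) <-> Lb_rel X (x, y).

Section Summand.
Variables (T : Type) (X Z : Lb_structure T).
Hypothesis XZ : Lb_summand X Z.

Lemma homomorphism_summand (U : Type) (W : Lb_structure U) (f : U -> T) :
  homomorphism W X f -> homomorphism W Z f.
Proof.
move=> [fdom frel]; split=> [x /fdom|x y /frel rX]; first exact: XZ.1.
by have [Xfx _] := Lb_rel_sub rX; apply/XZ.2; first by left.
Qed.

Lemma homomorphism_patch (U : Type) (W : Lb_structure U) (f g : T -> U) :
  homomorphism X W f -> homomorphism Z W g ->
  homomorphism Z W (patch g (Lb_dom X) f).
Proof.
move=> [fdom frel] [gdom grel]; split=> [x Zx|x y rZ].
  by rewrite /patch; case: ifPn => [/set_mem|_]; [exact: fdom | exact: gdom].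
have [/(XZ.2 _ _) rXZ|/not_orP[NXx NXy]] := pselect (Lb_dom X x \/ Lb_dom X y).
  have rX := rXZ.1 rZ; have [Xx Xy] := Lb_rel_sub rX.
  by rewrite !patchT ?inE//; exact: frel.
by rewrite !patchC ?inE//; exact: grel.
Qed.

Lemma condensation_patch_id (f : T -> T) :
  condensation X X f -> condensation Z Z (patch id (Lb_dom X) f).
Proof.
move=> [fhom fbij]; split; last exact: set_bij_patch_id XZ.1 fbij.
have idhom : homomorphism Z Z id by split=> // x.
by apply: homomorphism_patch idhom; exact: homomorphism_summand.
Qed.

Lemma reversible_summand : reversible Z -> reversible X.
Proof.
move=> revZ f fcond; have [[fdom _] fbij] := fcond.
have [_ giso] := revZ _ (condensation_patch_id fcond).
split=> // x y Xx Xy.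
have := giso x y (XZ.1 _ Xx) (XZ.1 _ Xy); rewrite !patchT ?inE//.
by rewrite !XZ.2; [|left; exact: fdom|left].
Qed.

End Summand.

Section Union.
Variables (T I : Type) (X : I -> Lb_structure T).

Lemma Lb_summand_union (K : set I) (i : I) :
  trivIset K (fun i => Lb_dom (X i)) -> K i -> Lb_summand (X i) (Lb_union K X).
Proof.
move=> dX Ki; split=> [x Xx|x y Xxy]; first by exists i.
split=> [[j Kj rj]|ri]; last by exists i.
have [Xjx Xjy] := Lb_rel_sub rj.
by rewrite (dX i j) //; case: Xxy => ?; [exists x | exists y].
Qed.

Lemma Lb_union_summand (J : set I) (Z : Lb_structure T) :
  (forall i, J i -> Lb_summand (X i) Z) -> Lb_summand (Lb_union J X) Z.
Proof.
move=> XZ; split=> [|x y Jxy]; first by apply: bigcup_sub => i /XZ[].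
split=> [rZ|[i Ji ri]].
  case: Jxy => -[i Ji Xi]; exists i => //; apply/(XZ i Ji).2 => //.
    by left.
  by right.
by have [Xx _] := Lb_rel_sub ri; apply/(XZ i Ji).2; first by left.
Qed.

End Union.

Theorem theorem2p1 (T I : Type) (X : I -> Lb_structure T)
    (hdisj : pairwise_disjoint X)
    (hconn : forall i : I, Lb_connected (X i)) :
  (reversible (Lb_union [set: I] X) <->
     forall J : set I, J !=set0 -> reversible (Lb_union J X)) /\
  (reversible (Lb_union [set: I] X) -> forall i : I, reversible (X i)).
Proof.
have XU i : Lb_summand (X i) (Lb_union [set: I] X) by exact: Lb_summand_union.
split; last by move=> revU i; exact: reversible_summand (XU i) revU.
split=> [revU J _|revJ].
  by apply: reversible_summand revU; exact: Lb_union_summand.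
have [I0|/set0P/revJ//] := eqVneq [set: I] set0.
by apply: reversible_dom0; rewrite /= I0 bigcup_set0.
Qed.
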